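(* Let $(L,\mu,\delta)$ be an InvDer associative algebra over $\mathbb{K}$, and let $R:L\to L$ be a Rota-Baxter operator of weight $0$ on $(L,\mu)$ such that $\delta\circ R=R\circ\delta$ and $\delta^{-1}\circ R=R\circ\delta^{-1}$. Then $(L,\ast,\delta)$ is an InvDer pre-Lie algebra, where $x\ast y=\mu(Rx,y)-\mu(y,Rx)$ for all $x,y\in L$.
   Context: $\mathbb{K}$ is a field of characteristic $0$. A derivation of an algebra $(L,\mu)$ is a linear map $d:L\to L$ with $d(\mu(x,y))=\mu(dx,y)+\mu(x,dy)$ for all $x,y$. $\mathrm{InvDer}(L)$ denotes the set of invertible derivations $\delta$ of the algebra $L$ such that $\delta^{-1}$ is also a derivation. A Rota-Baxter operator of weight $0$ on an algebra $(L,\mu)$ is a linear map $R:L\to L$ with $\mu(Rx,Ry)=R(\mu(Rx,y)+\mu(x,Ry))$ for all $x,y\in L$. An InvDer associative algebra $(L,\mu,\delta)$ is an associative algebra $(L,\mu)$ (not assumed unital) equipped with $\delta\in\mathrm{InvDer}(L)$ satisfying $\mu(\delta x,\mu(y,z))=\mu(\mu(x,y),\delta z)$ for all $x,y,z\in L$. A pre-Lie algebra is a vector space $L$ with a bilinear product $\ast$ such that $x\ast(y\ast z)-(x\ast y)\ast z=y\ast(x\ast z)-(y\ast x)\ast z$ for all $x,y,z\in L$. An InvDer pre-Lie algebra $(L,\ast,\delta)$ is a pre-Lie algebra $(L,\ast)$ equipped with $\delta\in\mathrm{InvDer}(L)$ satisfying $\delta x\ast(y\ast z)-(x\ast y)\ast\delta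 z=\delta y\ast(x\ast z)-(y\ast x)\ast\delta z$ for all $x,y,z\in L$. *)

(* Defs.v *)
From HB Require Import structures.
From mathcomp Require Import all_boot all_algebra.
Set Implicit Arguments.
Unset Strict Implicit.
Unset Printing Implicit Defensive.
Import GRing.Theory.
Local Open Scope ring_scope.

(* A (non-unital, a priori non-associative) algebra over K is a K-vector space
   L : lmodType K, of arbitrary dimension, together with a bilinear product
   L -> L -> L.  Being bilinear is part of the predicates below, so that it
   also has to be established for products that are built from others. *)
Section Algebras.
Variables (K : fieldType) (L : lmodType K).
Implicit Types (mu : L -> L -> L) (d R : L -> L).

Definition is_algebra mu : Prop :=
  (forall y, linear (mu ^~ y)) /\ (forall x, linear (mu x)).

Definition derivation mu d : Prop :=
  linear d /\ forall x y, d (mu x y) = mu (d x) y + mu x (d y).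

Definition InvDer mu d : Prop :=
  derivation mu d /\
  exists dinv, [/\ cancel d dinv, cancel dinv d & derivation mu dinv].

Definition rota_baxter0 mu R : Prop :=
  linear R /\ forall x y, mu (R x) (R y) = R (mu (R x) y + mu x (R y)).

Definition assoc_algebra mu : Prop := is_algebra mu /\ associative mu.

Definition InvDer_assoc_algebra mu d : Prop :=
  [/\ assoc_algebra mu, InvDer mu d &
      forall x y z, mu (d x) (mu y z) = mu (mu x y) (d z)].

Definition preLie_algebra mu : Prop :=
  is_algebra mu /\
  forall x y z, mu x (mu y z) - mu (mu x y) z = mu y (mu x z) - mu (mu y x) z.

Definition InvDer_preLie_algebra mu d : Prop :=
  [/\ preLie_algebra mu, InvDer mu d &
      forall x y z, mu (d x) (mu y z) - mu (mu x y) (d z)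
                  = mu (d y) (mu x z) - mu (mu y x) (d z)].

End Algebras.

(* Main.v *)
Require Import Defs.
From mathcomp Require Import all_boot all_algebra.
Set Implicit Arguments.
Unset Strict Implicit.
Unset Printing Implicit Defensive.
Import GRing.Theory.
Local Open Scope ring_scope.

(** The new product factors as [x * y = [R x, y]], where [[x, y]] is the
    commutator of the associative product, so everything is transported from
    the product to its commutator, and from the commutator to [*].

    Bilinearity passes through both steps because [R] is linear.  A derivation
    of the product is a derivation of its commutator, and then of [*] as soon
    as it commutes with [R]; this applies to [delta] and to its inverse.

    Both the pre-Lie identity and its [delta]-twisted version are instances,
    for [f = id] and [f = delta], of one identity
      [f x * (y * z) - (x * y) * f z  =  f y * (x * z) - (y * x) * f z],
    valid for each [f] that commutes with [R] and satisfies the twisted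
    associativity [(f x) (y z) = (x y) (f z)].  Such an [f] gives a twisted
    Jacobi identity for the commutator ([commutator_twisted_jacobi]):
      [[f a, [b, z]] - [f b, [a, z]]  =  [[a, b], f z]].
    Taking [a = R x] and [b = R y], the right-hand side is accounted for by
    the Rota-Baxter identity, which for the commutator reads
      [[R x, R y]  =  R (x * y - y * x)]. *)

Section CommutatorProducts.

Context {K : fieldType} {L : lmodType K}.
Variable mu : L -> L -> L.
Implicit Types (x y z a b : L) (R d f : L -> L).

Definition commutator x y := mu x y - mu y x.

Definition rb_product R x y := commutator (R x) y.

Lemma is_algebra_commutator : is_algebra mu -> is_algebra commutator.
Proof.
move=> [mul mur]; split=> y k u v; rewrite /commutator;
  by rewrite (mul y k u v) (mur y k u v) opprD addrACA scalerBr.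
Qed.

Lemma is_algebra_rb_product R :
  is_algebra mu -> linear R -> is_algebra (rb_product R).
Proof.
move=> /is_algebra_commutator[cl cr] linR; split=> [y k u v | x].
  by rewrite /rb_product linR (cl y k).
exact: cr.
Qed.

Lemma derivation_commutator d :
  derivation mu d -> derivation commutator d.
Proof.
move=> [lind dM]; split=> // x y; rewrite /commutator.
by rewrite (zmod_morphism_linear lind) !dM (addrC (mu (d y) x)) opprD addrACA.
Qed.

Lemma derivation_rb_product R d :
  derivation mu d -> d \o R =1 R \o d -> derivation (rb_product R) d.
Proof.
move=> /derivation_commutator[lind dC] dR; split=> // x y.
by rewrite /rb_product dC -[d (R x)]/((d \o R) x) dR.
Qed.

Hypothesis muB : is_algebra mu.

Let muBl x : zmod_morphism (mu ^~ x).
Proof. by case: muB => mul _; apply: zmod_morphism_linear (mul x). Qed.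

Let muBr x : zmod_morphism (mu x).
Proof. by case: muB => _ mur; apply: zmod_morphism_linear (mur x). Qed.

(** Twisted associativity moves [f] from an outer factor to the opposite outer
    factor, and so brings the four monomials to a form where the two with [z]
    in the middle are exchanged by swapping [a] and [b]. *)
Lemma commutator_twisted_expand f a b z :
    (forall x y z, mu (f x) (mu y z) = mu (mu x y) (f z)) ->
  commutator (f a) (commutator b z)
    = (mu (mu a b) (f z) + mu (f z) (mu b a))
      - (mu (f a) (mu z b) + mu (f b) (mu z a)).
Proof.
move=> fA; rewrite /commutator muBr (muBl (f a)) -(fA b z a) -(fA z b a).
by rewrite fA opprB addrACA -opprD.
Qed.

(** The terms with [z] in the middle are symmetric in [a] and [b], so only
    those with [z] at one end survive the antisymmetrization. *)
Lemma commutator_twisted_jacobi f a b z :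
    (forall x y z, mu (f x) (mu y z) = mu (mu x y) (f z)) ->
  commutator (f a) (commutator b z) - commutator (f b) (commutator a z)
    = commutator (commutator a b) (f z).
Proof.
move=> fA; rewrite !commutator_twisted_expand //.
rewrite [mu (f b) (mu z a) + _]addrC opprB subrKA.
by rewrite opprD addrACA /commutator muBr (muBl (f z)) opprB.
Qed.

Lemma rota_baxter0_commutator R x y :
    rota_baxter0 mu R ->
  commutator (R x) (R y) = R (rb_product R x y - rb_product R y x).
Proof.
move=> [linR RB]; rewrite /commutator !RB -(zmod_morphism_linear linR).
congr (R _); rewrite /rb_product /commutator opprB opprD.
by rewrite [- mu (R y) x + _]addrC addrACA.
Qed.

(** The twisted Jacobi identity at [R x], [R y], [z]: since [f] and [R]
    commute, the left factors [R (f x)] and [R (f y)] have the form it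
    requires. *)
Lemma rb_product_twisted_preLie R f x y z :
    rota_baxter0 mu R -> f \o R =1 R \o f ->
    (forall x y z, mu (f x) (mu y z) = mu (mu x y) (f z)) ->
  rb_product R (f x) (rb_product R y z) - rb_product R (rb_product R x y) (f z)
  = rb_product R (f y) (rb_product R x z)
    - rb_product R (rb_product R y x) (f z).
Proof.
move=> RB fR fA; have [linR _] := RB.
have [cl _] := is_algebra_commutator muB.
have subE s t u v : s - u = t - v -> s - t = u - v :> L.
  by move/eqP; rewrite subr_eq => /eqP->; rewrite -addrA addrC subrKA.
have RfE u v : rb_product R (f u) v = commutator (f (R u)) v.
  by rewrite /rb_product -[f (R u)]/((f \o R) u) fR.
rewrite !RfE; apply: subE.
rewrite [LHS](commutator_twisted_jacobi (R x) (R y) z fA).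
rewrite rota_baxter0_commutator // (zmod_morphism_linear linR).
exact: (zmod_morphism_linear (cl (f z))).
Qed.

End CommutatorProducts.

Theorem theorem3p9 (K : fieldType) (charK0 : [pchar K] =i pred0)
    (L : lmodType K) (mu : L -> L -> L) (delta delta_inv R : L -> L)
    (hL : InvDer_assoc_algebra mu delta)
    (deltaK : cancel delta delta_inv) (delta_invK : cancel delta_inv delta)
    (hR : rota_baxter0 mu R)
    (deltaR : delta \o R =1 R \o delta)
    (delta_invR : delta_inv \o R =1 R \o delta_inv) :
  InvDer_preLie_algebra (fun x y : L => mu (R x) y - mu y (R x)) delta.
Proof.
have [[muB muA] [dM [dinv [dK _ dinvM]]] dA] := hL.
have linR : linear R by case: hR.
have dinvE : dinv =1 delta_inv by move=> x; rewrite -{1}(delta_invK x) dK.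
rewrite -/(rb_product mu R); split.
- split; first exact: is_algebra_rb_product.
  by move=> x y z; apply: (@rb_product_twisted_preLie _ _ mu muB R id).
- split; first exact: derivation_rb_product.
  exists delta_inv; split=> //; apply: derivation_rb_product => //.
  by case: dinvM => lin der; split=> [k u v | u v]; rewrite -!dinvE ?lin ?der.
- by move=> x y z; apply: rb_product_twisted_preLie.
Qed.
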